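(* Assume Martin's Axiom together with $\neg\mathrm{CH}$. If $A\subseteq\omega^\omega$ is ${\bf\Sigma}^1_2$, then either there is a Hechler tree $H$ with $[H]\cap A=\emptyset$ or there is a Laver tree $L$ with $[L]\subseteq A$. Moreover, the same dichotomy holds for every set $A\subseteq\omega^\omega$ which is the union of $\omega_1$ many Borel sets.
   Context: A subtree of $\omega^{<\omega}$ is a nonempty subset closed under initial segments; $sn$ denotes the one-term extension of $s$ by $n$. A subtree $H$ is Hechler iff for every $s\in H$, $sn\in H$ for all but finitely many $n$. A subtree $L$ is Laver iff for every $s\in L$, $sn\in L$ for infinitely many $n$. $[T]=\{x\in\omega^\omega:\forall n\ x\upharpoonright n\in T\}$. *)

(* Defs.v *)
From HB Require Import structures.
From mathcomp Require Import all_boot all_order.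
From mathcomp Require Import all_classical.
From mathcomp Require wochoice.
From mathcomp Require Import topology measurable_structure.

Set Implicit Arguments.
Unset Strict Implicit.
Unset Printing Implicit Defensive.

Local Open Scope classical_set_scope.
Local Open Scope card_scope.

Definition baire : Type := prod_topology (fun _ : nat => nat).

HB.instance Definition _ := Pointed.on baire.
HB.instance Definition _ := Nbhs.on baire.
HB.instance Definition _ := Topological.on baire.
HB.instance Definition _ := Uniform.on baire.

Section Trees.
Implicit Types T : set (seq nat).

Definition subtree T :=
  T !=set0 /\ (forall s t, prefix s t -> T t -> T s).

Definition hechler T :=
  subtree T /\ (forall s, T s -> finite_set [set n | ~ T (rcons s n)]).

Definition laver T :=
  subtree T /\ (forall s, T s -> infinite_set [set n | T (rcons s n)]).

Definition branches T : set baire := [set x | forall n, T (mkseq x n)].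

End Trees.

Definition dichotomy (A : set baire) :=
  (exists2 H, hechler H & branches H `&` A = set0) \/
  (exists2 L, laver L & branches L `<=` A).

Section Pointclasses.
Variable X : topologicalType.
Implicit Type A : set X.

Definition borel A := <<s @open X >> A.

Definition Sigma11 A :=
  exists2 C : set (X * baire), closed C & A = fst @` C.

Definition Pi11 A := Sigma11 (~` A).

End Pointclasses.

Definition Sigma12 (X : topologicalType) (A : set X) :=
  exists2 C : set (X * baire), Pi11 C & A = fst @` C.

Definition continuum : set (set nat) := setT.

Definition CH :=
  forall X : set (set nat), countable X \/ X #= continuum.

(* (I, R) has order type omega_1: an uncountable well-order all of whose
   proper initial segments are countable. *)
Definition omega1_order (I : Type) (R : rel I) :=
  [/\ wochoice.well_order R, ~ countable [set: I]
    & forall i, countable [set j | R j i /\ j <> i]].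

Section Forcing.
Variables (P : Type) (le : rel P).
Implicit Types (p q r : P) (D G W : set P).

Definition compatible p q := exists r, le r p /\ le r q.

Definition antichain W :=
  forall p q, W p -> W q -> p <> q -> ~ compatible p q.

Definition ccc := forall W, antichain W -> countable W.

Definition forcing_dense D := forall p, exists2 d, D d & le d p.

Definition forcing_filter G :=
  [/\ G !=set0,
      forall p q, G p -> le p q -> G q
    & forall p q, G p -> G q -> exists r, [/\ G r, le r p & le r q]].

End Forcing.

(* "Fewer than continuum many" is strict inequality of cardinals: DD injects
   into the continuum but not conversely. *)
Definition MartinsAxiom :=
  forall (P : Type) (le : rel P),
    [set: P] !=set0 -> wochoice.partial_order le -> ccc le ->
  forall DD : set (set P),
    DD #<= continuum -> ~ (continuum #<= DD) ->
    (forall D, DD D -> forcing_dense le D) ->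
  exists2 G, forcing_filter le G & forall D, DD D -> D `&` G !=set0.

(* Main.v *)
Require Import Defs.
From mathcomp Require Import all_boot all_order.
From mathcomp Require Import all_classical.
From mathcomp Require Import topology measurable_structure.
From mathcomp Require wochoice.

Set Implicit Arguments.
Unset Strict Implicit.
Unset Printing Implicit Defensive.

Local Open Scope classical_set_scope.
Local Open Scope card_scope.

(** Both kinds of sets are projections of trees on omega x K with K of size
    omega_1: Borel sets are analytic, and a Sigma^1_2 set is handled by
    Shoenfield's tree of ranks.  For such a set consider the game in which one
    player bounds the next term from below and the opponent plays that term and,
    whenever he likes, a further term of a witness in K^omega.  If the first
    player wins, then his winning positions have well-founded rank, and the
    omega_1 many bounding functions arising at a position can be merged into a
    single one because Martin's Axiom (through Hechler forcing) dominates omega_1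
    many functions modulo finite; this gives a Hechler tree disjoint from A.
    Otherwise the opponent can keep infinitely many moves open while always
    reaching a further commitment in a position that is not lost, and his plays
    form a Laver tree inside A. *)

(** * Well-orders of type omega_1 *)

Section WellOrder.
Variables (I : Type) (R : rel I).
Hypothesis woR : wochoice.well_order R.

Let lt j i := R j i /\ j <> i.

Lemma well_order_min (A : set I) :
  A !=set0 -> exists2 m, A m & forall a, A a -> R m a.
Proof.
move=> [a Aa]; have [|m [[/asboolP Am mA] _]] := woR (A := fun x => `[<A x>]).
  by exists a; apply/asboolP.
by exists m => // b Ab; apply: mA; apply/asboolP.
Qed.

Lemma well_order_total : total R.
Proof.
move=> x y; have [|m [] -> mA] := @well_order_min [set x; y].
- by exists x; left.
- by rewrite (mA y) //; right.
- by rewrite (mA x) ?orbT //; left.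
Qed.

Lemma well_order_anti x y : R x y -> R y x -> x = y.
Proof.
move=> xy yx; have xx := well_order_total x x; have yy := well_order_total y y.
rewrite !orbb in xx yy.
have [|m [_ um]] := woR (A := fun z => `[<z = x \/ z = y>]).
  by exists x; apply/asboolP; left.
rewrite -(um x) ?(um y) //; split; try (by apply/asboolP; auto);
  by move=> z /asboolP[] ->.
Qed.

Lemma well_order_wf : well_founded lt.
Proof.
move=> x; apply: contrapT => nx.
have [|m nm mA] := @well_order_min [set z | ~ Acc lt z]; first by exists x.
apply: nm; split=> y [ym yNm]; apply: contrapT => ny; apply: yNm.
exact: well_order_anti ym (mA _ ny).
Qed.

End WellOrder.

(** Transfinite recursion in which each value need only suit the countable set of earlier values. It
    serves both to embed omega_1 x omega into uncountable sets and to rank well-founded trees in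
    omega_1. *)
Lemma wf_recursion_countable (X Y : Type) (lt : X -> X -> Prop)
    (P : set Y -> Y -> Prop) :
  well_founded lt -> (forall x, countable [set y | lt y x]) ->
  (forall S, countable S -> exists v, P S v) ->
  exists f : X -> Y, forall x, P (f @` [set y | lt y x]) (f x).
Proof.
move=> wf clt exP.
have [v0 _] := exP _ (@countable0 Y).
have /choice[c cP] : forall S, exists v, countable S -> P S v.
  move=> S; have [/exP[v Pv]|nS] := pselect (countable S); first by exists v.
  by exists v0 => /nS.
pose F x (g : forall y, lt y x -> Y) := c [set v | exists y h, g y h = v].
exists (Fix wf (fun=> Y) F) => x; rewrite Fix_eq; last first.
  move=> {}x f g fg; congr F.
  by apply: functional_extensionality_dep => y; apply: functional_extensionality_dep => h.
rewrite {2}/F; set S := image _ _; set S' := [set v | _].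
have -> : S' = S by apply/seteqP; split=> [v [y [h <-]]|_ [y h <-]];
  [exists y|exists y, h].
apply: cP; apply: (sub_countable (card_image_le _ _)); exact: clt.
Qed.

Lemma countable_setU (T : Type) (A B : set T) :
  countable A -> countable B -> countable (A `|` B).
Proof.
move=> cA cB; rewrite -bigcup2E; apply: bigcup_countable => // i _.
by rewrite /bigcup2; case: ifP => // _; case: ifP.
Qed.

Section Omega1.
Variables (I : Type) (R : rel I).
Hypothesis o1R : omega1_order R.

Lemma omega1_inh : inhabited I.
Proof.
case: o1R => _ nc _; apply: contrapT => nI; apply: nc.
rewrite (_ : setT = set0) //; apply/seteqP; split=> // i _.
by apply: nI; exists.
Qed.

(** If [S] were unbounded, the whole order would be the union of the countable closed initial
    segments ending at points of [S]. *)
Lemma omega1_bounded (S : set I) :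
  countable S -> exists v, forall w, S w -> R w v /\ w <> v.
Proof.
case: o1R => wo nc cR cS; apply: contrapT => nb; apply: nc.
suff -> : [set: I] = \bigcup_(w in S) ([set j | R j w /\ j <> w] `|` [set w]).
  apply: bigcup_countable => // w _.
  by apply: countable_setU; [exact: cR|exact: countable1].
apply/seteqP; split=> // v _; apply: contrapT => nv; apply: nb; exists v => w Sw.
have [vw|vw] := pselect (v = w); first by case: nv; exists w => //; right.
split; last by move=> wv; apply: vw.
have /orP[//|vRw] := well_order_total wo w v.
by case: nv; exists w => //; left.
Qed.

(** Recursion assigns to each [i] an injective sequence in [Y] avoiding all earlier sequences; these
    cover only countably many points, so room is left in [Y]. *)
Lemma omega1_card_le (T : Type) (Y : set T) :
  ~ countable Y -> [set: I * nat] #<= Y.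
Proof.
case: o1R => wo nc cR; elim/Ppointed: T => T in Y *.
  by rewrite emptyE => /(_ (countable0 _)).
move=> ncY.
have [] := @wf_recursion_countable I (nat -> T) (fun j i => R j i /\ j <> i)
  (fun S v => [/\ injective v, forall n, Y (v n) &
     forall w n m, S w -> v n <> w m]) (well_order_wf wo) cR.
  move=> S cS; pose Z := \bigcup_(w in S) (range w).
  have cZ : countable Z.
    by apply: bigcup_countable => // w _; apply: (sub_countable (card_image_le _ _)).
  have /infiniteP/pcard_leP[g] : infinite_set (Y `\` Z).
    move=> /finite_set_countable cYZ; apply: ncY.
    apply: (@sub_countable _ _ _ (Y `\` Z `|` Z)); last exact: countable_setU.
    apply: subset_card_le => y Yy; have [|] := pselect (Z y); first by right.
    by left.
  exists g; split.
  - by move=> n m; apply: inj; rewrite inE.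
  - by move=> n; have [] := @funS _ _ _ _ g n Logic.I.
  - move=> w n m Sw e; have [_] := @funS _ _ _ _ g n Logic.I; apply.
    by exists w => //; exists m.
move=> f fP; apply/pcard_leP/injfunPex; exists (fun p => f p.1 p.2).
  by move=> [i n] _ /=; have [_ + _] := fP i; apply.
move=> [i n] [j m] _ _ /= e.
have [ij|ij] := pselect (i = j).
  by subst j; congr pair; have [inj _ _] := fP i; apply: inj.
have /orP[ijR|jiR] := well_order_total wo i j.
- have [_ _ /(_ (f i) m n)] := fP j; rewrite e; case=> //; exists i => //; split=> //.
- have [_ _ /(_ (f j) n m)] := fP i; rewrite e; case=> //; exists j => //; split=> //.
  by move=> ji; apply: ij.
Qed.

End Omega1.

(** In a well-ordering of [T], keep the points with countably many predecessors. If only countably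
    many were kept, the least point left out would have all its predecessors among them and so would
    be kept. *)
Lemma omega1_exists (T : eqType) : ~ countable [set: T] ->
  exists (I : Type) (R : rel I), omega1_order R.
Proof.
move=> ncT; have [R wo] := wochoice.well_ordering_principle T.
pose seg z := [set j | R j z /\ j <> z].
pose J := {z : T | countable (seg z)}; exists J, (fun a b => R (sval a) (sval b)).
have svalI (a b : J) : sval a = sval b -> a = b.
  by case: a b => [a ca] [b cb] /= ab; subst b; congr exist; exact: Prop_irrelevance.
split.
- apply: wochoice.antisymmetric_well_order => [a b /andP[ab ba]|A [a Aa]].
    exact/svalI/(well_order_anti wo).
  have [|m [m' Am mE] mA] := well_order_min wo (A := sval @` [set` A]).
    by exists (sval a); exists a.
  by exists m'; split=> // b Ab; rewrite mE; apply: mA; exists b.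
- move=> cJ; pose Z := [set z | countable (seg z)].
  have cZ : countable Z.
    apply: (@sub_countable _ _ _ (sval @` [set: J])).
      by apply: subset_card_le => z cz; exists (exist _ z cz).
    exact: sub_countable (card_image_le _ _) cJ.
  have [z nz] : exists z, ~ Z z.
    apply: contrapT => nZ; apply: ncT; rewrite (_ : setT = Z) //.
    by apply/seteqP; split=> // z _; apply: contrapT => nz; apply: nZ; exists z.
  have [|m nm mA] := well_order_min wo (A := ~` Z); first by exists z.
  apply: nm; apply: (sub_countable _ cZ); apply: subset_card_le => j [jm jNm].
  by apply: contrapT => nj; apply: jNm; apply: (well_order_anti wo jm); apply: mA.
- move=> b; have cb : countable (seg (sval b)) by case: b.
  have /countable_injP[f fI] := cb; apply/countable_injP; exists (f \o sval).
  move=> a a'; rewrite !inE => -[ab aNb] [a'b a'Nb] /= e; apply/svalI/fI => //.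
  + by rewrite inE; split=> // /svalI.
  + by rewrite inE; split=> // /svalI.
Qed.

(** * Hechler forcing *)

Section HechlerForcing.

Let cond : Type := (seq nat * (nat -> nat))%type.

(** Hechler forcing: a condition is a finite stem with a lower bound that only terms added later to
    the stem must obey. *)
Definition hechler_ext (q p : cond) :=
  [/\ exists v, q.1 = p.1 ++ v, forall i, p.2 i <= q.2 i
    & forall i, size p.1 <= i < size q.1 -> p.2 i <= nth 0 q.1 i].

Definition hechler_le : rel cond := fun q p => `[<hechler_ext q p>].

Lemma hechler_le_order : wochoice.partial_order hechler_le.
Proof.
split; first split.
- move=> [s F]; apply/asboolP; split=> //=; first by exists [::]; rewrite cats0.
  by move=> i /andP[/leq_ltn_trans/[apply]]; rewrite ltnn.
- move=> [s F] [u G] [t H] /asboolP[/= [v ->] FG sv] /asboolP[/= [w sE] HF tw].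
  subst s; apply/asboolP; split=> /= [|i|i /andP[ti iu]].
  + by exists (w ++ v); rewrite catA.
  + exact: leq_trans (HF i) (FG i).
  + have [is_|is_] := ltnP i (size (t ++ w)).
      by rewrite nth_cat is_; apply: tw; rewrite ti.
    by apply: leq_trans (HF i) _; apply: sv; rewrite is_.
- move=> [s F] [t G] /andP[/asboolP[/= [v ->] GF _] /asboolP[/= [w +] FG _]].
  move=> /(congr1 size); rewrite !size_cat -addnA => /eqP.
  rewrite -[X in X == _]addn0 eqn_add2l eq_sym addn_eq0 => /andP[/nilP -> _].
  rewrite cats0; congr pair; apply: funext => i; apply/eqP.
  by rewrite eqn_leq FG GF.
Qed.

(** Conditions with equal stems are compatible through the maximum of their bounds, and there are
    only countably many stems. *)
Lemma hechler_le_ccc : ccc hechler_le.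
Proof.
move=> W aW; apply/countable_injP; exists (pickle \o fst) => p q.
rewrite !inE => Wp Wq /= /(pcan_inj pickleK) pq; apply: contrapT => pNq; apply: (aW _ _ Wp Wq pNq).
case: p q pq {Wp Wq pNq} => [s F] [_ G] /= <-.
exists (s, fun i => maxn (F i) (G i)).
split; apply/asboolP; split=> /=; try (by exists [::]; rewrite cats0);
  try (by move=> i; rewrite leq_max leqnn ?orbT);
  by move=> i /andP[/leq_ltn_trans/[apply]]; rewrite ltnn.
Qed.

Definition hechler_dense (F : nat -> nat) (n : nat) : set cond :=
  [set p | n <= size p.1 /\ forall i, F i <= p.2 i].

Lemma hechler_denseP F n : forcing_dense hechler_le (hechler_dense F n).
Proof.
move=> [s G].
exists (s ++ mkseq (fun i => G (size s + i)) n, fun i => maxn (F i) (G i)).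
  by split=> /= [|i]; rewrite ?size_cat ?size_mkseq ?leq_addl // leq_maxl.
apply/asboolP; split=> /= [|i|i]; first by eexists.
  exact: leq_maxr.
rewrite size_cat size_mkseq => /andP[si is_]; rewrite nth_cat ltnNge si /=.
by rewrite nth_mkseq ?subnKC // ltn_subLR.
Qed.

End HechlerForcing.

Definition dominating (K : Type) := forall F : K -> seq nat -> nat,
  exists f, forall k, exists N, forall u, N <= size u -> F k u <= f u.

Lemma eventually_dominated (I : Type) (R : rel I) (F : I * nat -> nat -> nat) :
  MartinsAxiom -> ~ CH -> omega1_order R ->
  exists f, forall k, exists N, forall n, N <= n -> F k n <= f n.
Proof.
move=> ma nch o1R.
have [X] : exists X : set (set nat), ~ (countable X \/ X #= continuum).
  by apply: contrapT => nX; apply: nch => X; apply: contrapT => h; apply: nX; exists X.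
move=> /not_orP[ncX XNc].
(* The index [k.2] doubles as a required stem length, so that this one family also forces
   arbitrarily long stems. *)
pose D k := hechler_dense (F k) k.2.
(* [X] is uncountable but smaller than the continuum, so aleph_1 many dense sets are few enough for
   Martin's Axiom. *)
have DDX : range D #<= X.
  exact: card_le_trans (card_image_le _ _) (omega1_card_le o1R ncX).
have [] := ma _ hechler_le _ hechler_le_order hechler_le_ccc (range D).
- by exists ([::], id).
- exact: card_le_trans DDX (card_leT _).
- move=> cDD; apply: XNc; apply: Cantor_Bernstein; first exact: card_leT.
  exact: card_le_trans cDD DDX.
- by move=> _ [k _ <-]; apply: hechler_denseP.
move=> G [_ _ dirG] meetG.
have [i0] := omega1_inh o1R.
have /choice[g gP] : forall n, exists p, G p /\ n < size p.1.
  by move=> n; have [|p [[np _] Gp]] := meetG (D (i0, n.+1)); [exists (i0, n.+1)|exists p].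
exists (fun n => nth 0 (g n).1 n) => k.
have [|p [[_ Fp] Gp]] := meetG (D k); first by exists k.
exists (size p.1) => n pn; have [Gg ng] := gP n.
(* The common extension [r] keeps the value of [g n] at [n]; as [n] lies past the stem of [p], this
   value obeys the bound of [p]. *)
have [r [_ /asboolP[_ _ rp] /asboolP[[v rE] _ _]]] := dirG _ _ Gp Gg.
have nE : nth 0 r.1 n = nth 0 (g n).1 n by rewrite rE nth_cat ng.
rewrite -nE; apply: leq_trans (Fp n) _; apply: rp.
by rewrite pn rE size_cat (leq_trans ng) // leq_addr.
Qed.

Lemma dominating_omega1 (I : Type) (R : rel I) :
  MartinsAxiom -> ~ CH -> omega1_order R -> dominating (I * nat).
Proof.
move=> ma nch o1R F.
(* The maximum over all codes up to [n] allows evaluation at [pickle u + size u], which is at least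
   the code of [u] and is large as soon as [u] is long. *)
pose F' k n := \max_(j < n.+1) odflt 0 (omap (F k) (unpickle j)).
have [f fP] := eventually_dominated F' ma nch o1R.
exists (fun u => f (pickle u + size u)) => k; have [N NP] := fP k.
exists N => u Nu; apply: leq_trans (NP _ _); last exact: leq_trans (leq_addl _ _).
have pu : pickle u < (pickle u + size u).+1 by rewrite ltnS leq_addr.
have <- : odflt 0 (omap (F k) (unpickle (pickle u))) = F k u by rewrite pickleK.
exact: (@leq_bigmax _ (fun j : 'I_(pickle u + size u).+1 =>
  odflt 0 (omap (F k) (unpickle j))) (Ordinal pu)).
Qed.

(** * The unfolded Hechler-Laver game *)

Definition agree (K : Type) (n : nat) (x y : nat -> K) :=
  forall i, i < n -> x i = y i.

Lemma agree_mkseq (K : Type) n (x y : nat -> K) :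
  mkseq x n = mkseq y n -> agree n x y.
Proof. by move=> e i ni; rewrite -(nth_mkseq (x i) x ni) e nth_mkseq. Qed.

(** Closedness in omega^omega x K^omega with [K] discrete, so that [suslin] sets are the projections
    of trees on omega x K. *)
Definition finitely_closed (K : Type) (C : (nat -> nat) -> (nat -> K) -> Prop) :=
  forall x y,
  (forall n, exists x' y', [/\ agree n x' x, agree n y' y & C x' y']) -> C x y.

Definition suslin (K : Type) (A : set baire) :=
  exists2 C : (nat -> nat) -> (nat -> K) -> Prop,
    finitely_closed C & forall x : baire, A x <-> exists y, C x y.

Section Game.
Variables (K : Type) (k0 : K) (C : (nat -> nat) -> (nat -> K) -> Prop).
Hypothesis closedC : finitely_closed C.

Definition alive s t := exists x y,
  [/\ C x y, mkseq x (size s) = s & mkseq y (size t) = t].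

Inductive follows (f : seq nat -> nat) (s : seq nat) : seq nat -> Prop :=
| follows_one n : f s <= n -> follows f s (rcons s n)
| follows_rcons u n : follows f s u -> f u <= n -> follows f s (rcons u n).

(* [won s t]: the player building the Hechler tree wins from the position where
   [s] has been played and the opponent has committed to the initial segment
   [t] of a witness.  The opponent may delay each commitment. *)
Inductive won : seq nat -> seq K -> Prop :=
| won_dead s t : ~ alive s t -> won s t
| won_step s t f :
    (forall u k, follows f s u -> won u (rcons t k)) -> won s t.

Lemma follows_mkseq f s (x : nat -> nat) m : mkseq x (size s) = s ->
  (forall j, size s <= j -> f (mkseq x j) <= x j) ->
  size s < m -> follows f s (mkseq x m).
Proof.
move=> xs fx; elim: m => // m IH; rewrite ltnS leq_eqVlt => /orP[/eqP sm|sm].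
  by rewrite mkseqS -sm xs; apply: follows_one; rewrite -{1}xs; apply: fx.
by rewrite mkseqS; apply: follows_rcons; [exact: IH|exact/fx/ltnW].
Qed.

Lemma won_avoid : dominating K -> forall s t, won s t ->
  exists f : seq nat -> nat, forall x y,
  mkseq x (size s) = s -> mkseq y (size t) = t ->
  (forall j, size s <= j -> f (mkseq x j) <= x j) -> ~ C x y.
Proof.
move=> domK s t; elim=> {s t} [s t dead|s t f _ IH].
  by exists (fun=> 0) => x y xs yt _ Cxy; apply: dead; exists x, y.
have /choice[g gP] : forall p : seq nat * K, exists g : seq nat -> nat,
    follows f s p.1 -> forall x y,
    mkseq x (size p.1) = p.1 -> mkseq y (size (rcons t p.2)) = rcons t p.2 ->
    (forall j, size p.1 <= j -> g (mkseq x j) <= x j) -> ~ C x y.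
  move=> [u k]; have [fu|fu] := pselect (follows f s u).
    by have [g gP] := IH u k fu; exists g.
  by exists (fun=> 0).
(* The moment of the next commitment is unknown, so the bound covers every prefix of [u] where it
   may occur. Only [k] remains as an index, and [dominating K] applies. *)
pose F k u := \max_(n < (size u).+1) g (take n u, k) u.
have [h hP] := domK F.
exists (fun u => maxn (f u) (h u)) => x y xs yt fx Cxy.
have [N NP] := hP (y (size t)).
(* The successor makes [u] a proper extension of [s], as [follows] demands. *)
pose m := (maxn N (size s)).+1; pose u := mkseq x m.
have Nm : N <= m by rewrite ltnW // ltnS leq_maxl.
have fu : follows f s u.
  apply: follows_mkseq => [//|j sj|]; last by rewrite ltnS leq_maxr.
  by apply: leq_trans (fx j sj); rewrite leq_maxl.
apply: (gP (u, y (size t)) fu x y _ _ _ Cxy).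
- by rewrite [_.1]/= size_mkseq.
- by rewrite [_.2]/= size_rcons mkseqS yt.
rewrite [_.1]/= size_mkseq => j mj.
have sj : size s <= j by apply: leq_trans mj; rewrite ltnW // ltnS leq_maxr.
apply: leq_trans (fx j sj); rewrite leq_max; apply/orP; right.
apply: leq_trans (NP _ _); last by rewrite size_mkseq (leq_trans Nm).
have mlt : m < (size (mkseq x j)).+1 by rewrite size_mkseq.
have -> : u = take (Ordinal mlt) (mkseq x j).
  by rewrite /= /mkseq -map_take take_iota (minn_idPl mj).
exact: (@leq_bigmax _ (fun n : 'I_(size (mkseq x j)).+1 =>
  g (take n (mkseq x j), y (size t)) (mkseq x j)) (Ordinal mlt)).
Qed.

Definition above (f : seq nat -> nat) : set (seq nat) :=
  [set s | forall j, j < size s -> f (take j s) <= nth 0 s j].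

Lemma above_hechler f : hechler (above f).
Proof.
split; first split.
- by exists [::].
- move=> s t /prefixP[v ->] st j js.
  have := st j; rewrite size_cat (leq_trans js) ?leq_addr // => /(_ isT).
  by rewrite nth_cat js take_cat js.
- move=> s fs; apply: (sub_finite_set _ (finite_II (f s))) => n /=.
  apply: contra_notP => /negP; rewrite -leqNgt => fn j.
  rewrite size_rcons ltnS nth_rcons => js; rewrite -cats1 take_cat.
  have [jlt|] := ltnP j (size s); first exact: fs.
  move=> sj; have -> : j = size s by apply/eqP; rewrite eqn_leq js.
  by rewrite subnn take0 cats0 eqxx.
Qed.

Lemma above_branches f x : branches (above f) x ->
  forall j, f (mkseq x j) <= x j.
Proof.
move=> fx j; have := fx j.+1 j; rewrite size_mkseq => /(_ (ltnSn j)).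
by rewrite nth_mkseq // /mkseq -map_take take_iota (minn_idPl (leqnSn j)).
Qed.

(* A well-founded strategy of the opponent that keeps infinitely many moves
   open and forces a further commitment in a position that is not [won].  It
   lives in [Type] so that it can serve as the state of a deterministic
   automaton whose runs form the Laver tree. *)
Inductive reach (t : seq K) (s : seq nat) : Type :=
  Reach (N1 N2 : set nat) of infinite_set (N1 `|` N2)
    & (forall n, N1 n -> reach t (rcons s n))
    & (forall n, N2 n -> {k | ~ won (rcons s n) (rcons t k)}).

Lemma infinite_unbounded (A : set nat) :
  (forall m, exists2 n, m <= n & A n) -> infinite_set A.
Proof.
move=> uA /finite_seqP[X AX].
have [n nX] := uA (\max_(i <- X) i).+1; rewrite AX /= => Xn.
by have := @leq_bigmax_seq _ X xpredT id n Xn isT; rewrite leqNgt nX.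
Qed.

Lemma not_won_reach s t : ~ won s t -> reach t s.
Proof.
move=> nw; apply: unsquash; apply: contrapT => nr; apply: nw.
pose good u := $|reach t u| \/ exists k, ~ won u (rcons t k).
(* Without a [reach] at [u], the good one-term extensions of [u] are bounded, as infinitely many
   would provide one. A play obeying these bounds never becomes good. *)
have /choice[f fP] : forall u, exists m, ~ $|reach t u| ->
    forall n, m <= n -> ~ good (rcons u n).
  move=> u; have [ru|nru] := pselect ($|reach t u|); first by exists 0.
  apply: contrapT => nm; apply: nru.
  apply: squash; apply: (@Reach t u [set n | $|reach t (rcons u n)|]
    [set n | exists k, ~ won (rcons u n) (rcons t k)]).
  - apply: infinite_unbounded => m; apply: contrapT => nn; apply: nm.
    by exists m => _ n mn gn; apply: nn; exists n.
  - by move=> n /unsquash.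
  - by move=> n /cid.
apply: (@won_step _ _ f) => u k fu.
suff : ~ good u by move=> /not_orP[_] /forallNP/(_ k)/contrapT.
by elim: fu => [n fn|v n _ /not_orP[nv _] fn]; apply: fP.
Qed.

(** * The opponent's plays as runs of an automaton *)

Definition state : Type := {p : seq nat * seq K & reach p.2 p.1}.
Definition pos (a : state) := (projT1 a).1.
Definition word (a : state) := (projT1 a).2.

(** Committing takes precedence when both kinds of move are open; afterwards [not_won_reach]
    supplies a fresh strategy for the new position. *)
Definition next (a : state) (n : nat) : option state :=
  let: existT p (Reach N1 N2 _ g1 g2) := a in
  match pselect (N2 n) with
  | left h => let: exist k nw := g2 n h in
      Some (existT _ (rcons p.1 n, rcons p.2 k) (not_won_reach nw))
  | right _ => match pselect (N1 n) with
    | left h => Some (existT _ (rcons p.1 n, p.2) (g1 n h))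
    | right _ => None
    end
  end.

Lemma next_infinite a : infinite_set [set n | next a n <> None].
Proof.
case: a => p [N1 N2 inf g1 g2]; apply: (sub_infinite_set _ inf) => n /= N12.
case: pselect => [h|n2]; first by case: (g2 n h).
by case: pselect => // n1; case: N12.
Qed.

Definition commits (a b : state) :=
  (exists k, word b = rcons (word a) k) /\ ~ won (pos b) (word b).

Lemma next_pos a b n : next a n = Some b -> pos b = rcons (pos a) n.
Proof.
case: a => p [N1 N2 inf g1 g2] /=.
case: pselect => [h|n2]; first by case: (g2 n h) => k nw [<-].
by case: pselect => // n1 [<-].
Qed.

Lemma next_word a b n : next a n = Some b -> word b = word a \/ commits a b.
Proof.
case: a => p [N1 N2 inf g1 g2] /=.
case: pselect => [h|n2]; last by case: pselect => // n1 [<-]; left.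
by case: (g2 n h) => k nw [<-]; right; split => //; exists k.
Qed.

(** Moves without commitment descend in the well-founded strategy tree [reach], so only finitely
    many can come in a row. *)
Lemma run_commits (tau : nat -> state) (x : nat -> nat) i :
  (forall j, next (tau j) (x j) = Some (tau j.+1)) ->
  exists2 j, i < j & commits (tau i) (tau j).
Proof.
move=> run; case E: (tau i) => [[s t] r].
move: (r : reach t s) E => {}r E; elim: r i E => {}s N1 N2 inf g1 IH g2 i E.
have := run i; rewrite E /=; case: pselect => [h|n2].
  case: (g2 _ h) => k nw [e]; exists i.+1 => //; rewrite -e; split => //=.
  by exists k.
case: pselect => // n1 [e].
have [j ij cj] := IH _ n1 i.+1 (esym e).
by exists j; [exact: ltnW|].
Qed.

Section LaverTree.
Hypothesis not_won0 : ~ won [::] [::].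

Let a0 : state := existT _ ([::], [::]) (not_won_reach not_won0).

Definition run (s : seq nat) : option state :=
  foldl (fun o n => obind (next^~ n) o) (Some a0) s.

Definition laver_tree : set (seq nat) := [set s | run s <> None].

Lemma laver_treeP : laver laver_tree.
Proof.
split; first split.
- by exists [::].
- move=> s t /prefixP[v ->]; rewrite /laver_tree /run /= foldl_cat.
  by case: (foldl _ _ s) => // nv; case: nv; elim: v.
- move=> s; rewrite /laver_tree /=; case E: (run s) => [a|] // _.
  apply: (sub_infinite_set _ (@next_infinite a)) => n /=.
  by rewrite /run foldl_rcons -/(run s) E.
Qed.

Lemma laver_tree_branches x : branches laver_tree x -> exists y, C x y.
Proof.
move=> Lx.
have /choice[tau tauE] : forall n, exists a, run (mkseq x n) = Some a.
  by move=> n; have := Lx n; rewrite /laver_tree /=; case: (run _) => [a _|//]; exists a.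
have runx j : next (tau j) (x j) = Some (tau j.+1).
  by have := tauE j.+1; rewrite mkseqS /run foldl_rcons -/(run _) tauE.
have tau0 : tau 0 = a0 by have [->] := tauE 0.
have posx j : pos (tau j) = mkseq x j.
  elim: j => [|j IH]; first by rewrite tau0.
  by rewrite (next_pos (runx j)) IH mkseqS.
have wordS j d : exists v, word (tau (j + d)) = word (tau j) ++ v.
  elim: d => [|d [v IH]]; first by exists [::]; rewrite addn0 cats0.
  rewrite addnS; have [->|[[k ->] _]] := next_word (runx (j + d)).
    by exists v.
  by exists (rcons v k); rewrite IH rcons_cat.
have wordE i j n : n < size (word (tau i)) -> n < size (word (tau j)) ->
    nth k0 (word (tau i)) n = nth k0 (word (tau j)) n.
  wlog ij : i j / i <= j => [H ni nj|ni _].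
    by have /orP[ij|ji] := leq_total i j; [exact: H|exact/esym/H].
  have [v] := wordS i (j - i); rewrite subnKC // => ->.
  by rewrite nth_cat ni.
(* Repeated commitments make the words arbitrarily long, each time at a position that is not [won],
   hence alive and extended by a point of [C]. *)
have /choice[J JP] : forall n, exists j, [/\ n <= j, n <= size (word (tau j))
    & ~ won (pos (tau j)) (word (tau j))].
  elim=> [|n [j [nj nw _]]]; first by exists 0; rewrite tau0.
  have [i ji [[k wi] ni]] := run_commits j runx.
  exists i; split=> //; first exact: leq_ltn_trans ji.
  by rewrite wi size_rcons.
(* The word at stage [J n.+1] has more than [n] terms, so the default [k0] is never read. *)
exists (fun n => nth k0 (word (tau (J n.+1))) n); apply: closedC => n.
have [nj nw] := JP n; set p := pos _; set w := word _ => npw.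
have [x' [y' [Cxy xp yw]]] : alive p w.
  by apply: contrapT => /won_dead.
exists x', y'; split=> // i ni.
- move: xp; rewrite /p posx size_mkseq => /agree_mkseq.
  by apply; exact: leq_trans nj.
- have inw := leq_trans ni nw.
  rewrite -(nth_mkseq k0 y' inw) yw; apply: wordE => //.
  by have [] := JP i.+1.
Qed.

End LaverTree.

End Game.

Theorem suslin_dichotomy (K : Type) (A : set baire) :
  K -> dominating K -> suslin K A -> dichotomy A.
Proof.
move=> k0 domK [C closedC CA].
have [w0|nw0] := pselect (won C [::] [::]).
  left; have [f fP] := won_avoid domK w0; exists (above f).
    exact: above_hechler.
  apply/seteqP; split=> // x [/above_branches fx /CA[y]].
  by apply: (fP x y) => // j _.
right; exists (laver_tree nw0); first exact: laver_treeP.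
by move=> x /(laver_tree_branches k0 closedC) /CA.
Qed.

(** * Suslin representations *)

Lemma agree_le (K : Type) n m (x y : nat -> K) :
  n <= m -> agree m x y -> agree n x y.
Proof. by move=> nm xy i ni; apply: xy; exact: leq_trans nm. Qed.

Lemma baire_cvg (u : nat -> baire) (x : baire) :
  (forall n, agree n (u n) x) -> u @ \oo --> x.
Proof.
move=> ux; apply/cvg_sup => i U [V [[W oW <-] Wx WU]].
exists i.+1 => // n /= ni; apply: WU => /=.
by rewrite /= in Wx *; rewrite (ux n).
Qed.

Lemma open_baire (U : set baire) (x : baire) : open U -> U x ->
  exists N, forall x' : baire, agree N x' x -> U x'.
Proof.
move=> oU Ux; apply: contrapT => nN.
have /choice[u uP] : forall n, exists x' : baire, agree n x' x /\ ~ U x'.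
  move=> n; apply: contrapT => nx; apply: nN; exists n => x' x'x.
  by apply: contrapT => nUx; apply: nx; exists x'.
have cU : closed (~` U) by exact: open_closedC.
have ux : u @ \oo --> x by apply: baire_cvg => n; have [] := uP n.
suff : (~` U) x by [].
apply: (closed_cvg _ cU _ _ ux).
by apply: nearW => n; have [] := uP n.
Qed.

Lemma closed_baire (A : set baire) (x : baire) : closed A ->
  (forall n, exists2 x' : baire, agree n x' x & A x') -> A x.
Proof.
move=> cA xA; apply: contrapT => nAx.
have [N NA] := open_baire (closed_openC cA) nAx.
by have [x' /NA] := xA N.
Qed.

Lemma closed_baire3 (D : set (baire * baire * baire)) (x y z : baire) :
  closed D ->
  (forall n, exists x' y' z' : baire,
    [/\ D (x', y', z'), agree n x' x, agree n y' y & agree n z' z]) ->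
  D (x, y, z).
Proof.
move=> cD apD.
have /choice[p pP] : forall n, exists p : baire * baire * baire,
    [/\ D p, agree n p.1.1 x, agree n p.1.2 y & agree n p.2 z].
  by move=> n; have [x' [y' [z' [? ? ? ?]]]] := apD n; exists (x', y', z').
apply: (closed_cvg (F := \oo) (u_ := fun n => ((p n).1.1, (p n).1.2, (p n).2)) _ cD).
  by apply: nearW => n; have [+ _ _ _] := pP n; case: (p n) => [[]].
have c1 : (p n).1.1 @[n --> \oo] --> x by apply: baire_cvg => n; have [] := pP n.
have c2 : (p n).1.2 @[n --> \oo] --> y by apply: baire_cvg => n; have [] := pP n.
have c3 : (p n).2 @[n --> \oo] --> z by apply: baire_cvg => n; have [] := pP n.
exact: cvg_pair (cvg_pair c1 c2) c3.
Qed.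

Lemma suslin_closed (A : set baire) : closed A -> suslin nat A.
Proof.
move=> cA; exists (fun x _ => A x).
  move=> x y ap; apply: closed_baire => // n.
  by have [x' [_ [x'x _ Ax']]] := ap n; exists x'.
by move=> x; split=> [Ax|[]//]; exists id.
Qed.

(** The first term of a witness is the length of an initial segment of [x] that already forces
    membership in [U]. *)
Lemma suslin_open (U : set baire) : open U -> suslin nat U.
Proof.
move=> oU; exists (fun x y => forall x' : baire, agree (y 0) x' x -> U x').
  move=> x y ap x' x'x; have [x1 [y1 [x1x y1y]]] := ap (y 0).+1; apply.
  by rewrite y1y // => i iy; rewrite x'x // x1x // ltnW.
move=> x; split=> [/(open_baire oU)[N NU]|[y]]; first by exists (fun=> N).
exact.
Qed.

Lemma suslin_surj (K K' : Type) (g : K -> K') (h : K' -> K) (A : set baire) :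
  cancel g h -> suslin K A -> suslin K' A.
Proof.
move=> gK [C cC CA]; exists (fun x y => C x (h \o y)).
  move=> x y ap; apply: cC => n; have [x' [y' [x'x y'y Cxy]]] := ap n.
  by exists x', (h \o y'); split=> // i ni /=; rewrite y'y.
move=> x; rewrite CA; split=> [[y Cxy]|[y Cxy]]; last by exists (h \o y).
by exists (g \o y); rewrite (_ : h \o _ = y) //; apply: funext => i /=; rewrite gK.
Qed.

(** The first term of a witness names the index [i]; the [nat] components of the later terms form a
    witness for [B i]. *)
Lemma suslin_bigcup (I : Type) (B : I -> set baire) :
  (forall i, suslin nat (B i)) -> suslin (I * nat) (\bigcup_i B i).
Proof.
move=> sB.
have /choice[C CP] : forall i, exists C : (nat -> nat) -> (nat -> nat) -> Prop,
    finitely_closed C /\ forall x : baire, B i x <-> exists y, C x y.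
  by move=> i; have [C] := sB i; exists C.
exists (fun x y => C (y 0).1 x (fun n => (y n.+1).2)).
  move=> x y ap; have [cC _] := CP (y 0).1; apply: cC => n.
  have [x' [y' [x'x y'y Cxy]]] := ap n.+1.
  exists x', (fun n => (y' n.+1).2); rewrite -(y'y 0) //; split=> // i ni.
    by apply: x'x; exact: ltnW.
  by rewrite y'y.
move=> x; split=> [[i _ Bx]|[y Cxy]].
  have [_ /(_ x)[/(_ Bx)[y Cxy] _]] := CP i.
  by exists (fun n => (i, y n.-1)).
by exists (y 0).1 => //; have [_ ->] := CP (y 0).1; exists (fun n => (y n.+1).2).
Qed.

Lemma suslin_bigcap (B : nat -> set baire) :
  (forall i, suslin nat (B i)) -> suslin nat (\bigcap_i B i).
Proof.
move=> sB.
have /choice[C CP] : forall i, exists C : (nat -> nat) -> (nat -> nat) -> Prop,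
    finitely_closed C /\ forall x : baire, B i x <-> exists y, C x y.
  by move=> i; have [C] := sB i; exists C.
exists (fun x y => forall i, C i x (fun j => y (pickle (i, j)))).
  move=> x y ap i; have [cC _] := CP i; apply: cC => n.
  pose m := \max_(j < n) (pickle (i, nat_of_ord j)).+1.
  have [x' [y' [x'x y'y Cxy]]] := ap (maxn n m).
  exists x', (fun j => y' (pickle (i, j))); split=> //.
    by apply: agree_le x'x; rewrite leq_maxl.
  move=> j jn; apply: y'y; rewrite leq_max; apply/orP; right.
  exact: (@leq_bigmax _ (fun j : 'I_n => (pickle (i, nat_of_ord j)).+1) (Ordinal jn)).
move=> x; split=> [Bx|[y Cxy] i _]; last first.
  by have [_ ->] := CP i; exists (fun j => y (pickle (i, j))).
have /choice[y yP] : forall i, exists y, C i x y.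
  by move=> i; have [_ <-] := CP i; exact: Bx.
exists (fun n => if unpickle n is Some (i, j) then y i j else 0) => i.
rewrite (_ : (fun j => _) = y i) //; apply: funext => j.
by rewrite (pickleK (i, j)).
Qed.

(** The sets that are Suslin together with their complements form a sigma-algebra containing the
    open sets. *)
Lemma suslin_borel (A : set baire) : borel A -> suslin nat A.
Proof.
suff sA : <<s @open baire >> `<=` [set A | suslin nat A /\ suslin nat (~` A)].
  by move=> /sA[].
apply: smallest_sub => [|U oU]; last first.
  by split; [exact: suslin_open|apply: suslin_closed; exact: open_closedC].
have bigcupS (B : nat -> set baire) :
    (forall i, suslin nat (B i)) -> suslin nat (\bigcup_i B i).
  move=> /suslin_bigcup; apply: (@suslin_surj _ _ pickle
    (fun n => odflt (0, 0) (unpickle n))) => p.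
  by rewrite pickleK.
split=> [|B [sB sCB]|B sB].
- split; rewrite ?setC0; apply: suslin_open; [exact: open0|exact: openT].
- by split; rewrite setTD ?setCK.
- split; first by apply: bigcupS => i; have [] := sB i.
  by rewrite setC_bigcup; apply: suslin_bigcap => i; have [] := sB i.
Qed.

(** * Shoenfield's tree for Sigma^1_2 sets *)

Section Shoenfield.
Variables (I : Type) (R : rel I) (D : set (baire * baire * baire)).
Hypotheses (o1R : omega1_order R) (closedD : closed D).

Let lt j i := R j i /\ j <> i.

Definition approx (x y : nat -> nat) (u : seq nat) := exists x' y' z' : baire,
  [/\ D (x', y', z'), agree (size u) x' x, agree (size u) y' y
    & mkseq z' (size u) = u].

Lemma approx_agree x y x' y' u : agree (size u) x' x -> agree (size u) y' y ->
  approx x y u -> approx x' y' u.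
Proof.
move=> xx yy [x1 [y1 [z1 [Dz x1x y1y z1u]]]]; exists x1, y1, z1; split=> // i iu.
- by rewrite x1x // xx.
- by rewrite y1y // yy.
Qed.

(** An infinite chain of growing attempts would converge to some [z], and [closedD] would put
    [(x, y, z)] in [D]. *)
Lemma approx_wf (x y : baire) : ~ (exists z, D (x, y, z)) ->
  well_founded (fun v u => (exists a, v = rcons u a) /\ approx x y v).
Proof.
move=> nz u0; set child := (X in Acc X u0); apply: contrapT => nu0.
have /choice[c cP] : forall u, exists v,
    ~ Acc child u -> child v u /\ ~ Acc child v.
  move=> u; have [|nu] := pselect (Acc child u); first by exists u.
  apply: contrapT => nv; apply: nu; split=> v vu; apply: contrapT => nav.
  by apply: nv; exists v.
pose v n := iter n c u0.
have vP n : ~ Acc child (v n) by elim: n => // n /cP[].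
have vS n : child (v n.+1) (v n) by have [] := cP _ (vP n).
have sv n : n <= size (v n).
  elim: n => // n IH; have [[a ->] _] := vS n.
  by rewrite size_rcons.
have vcat n d : exists w, v (n + d) = v n ++ w.
  elim: d => [|d [w IH]]; first by exists [::]; rewrite addn0 cats0.
  rewrite addnS; have [[a ->] _] := vS (n + d).
  by exists (rcons w a); rewrite IH rcons_cat.
have vE n m i : n <= m -> i < size (v n) -> nth 0 (v m) i = nth 0 (v n) i.
  by move=> nm ni; have [w] := vcat n (m - n); rewrite subnKC // => ->; rewrite nth_cat ni.
apply: nz; exists (fun i => nth 0 (v i.+1) i).
apply: closed_baire3 => // n.
have [_ [x' [y' [z' [Dz x'x y'y z'v]]]]] := vS n.
have nv : n <= size (v n.+1) by apply: ltnW.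
exists x', y', z'; split=> //; [exact: agree_le x'x|exact: agree_le y'y|].
move=> i ni; rewrite -(nth_mkseq 0 z' (leq_trans ni nv)) z'v.
by apply: vE; rewrite ?sv // ltnS ltnW.
Qed.

(* A witness codes a point [y] together with a rank function into omega_1 of
   the tree of attempts to find [z] with [D (x, y, z)]. *)
Definition ranked (x : nat -> nat) (w : nat -> I * nat) := forall u a,
  approx x (snd \o w) (rcons u a) ->
  lt (w (pickle (rcons u a))).1 (w (pickle u)).1.

Lemma ranked_closed : finitely_closed ranked.
Proof.
move=> x w ap u a xu.
have [x' [w' [x'x w'w]]] := ap (maxn (size u).+1
  (maxn (pickle u).+1 (pickle (rcons u a)).+1)).
move=> /(_ u a); rewrite !w'w ?leq_max ?leqnn ?orbT //; apply.
apply: approx_agree xu; rewrite size_rcons => i iu.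
- by apply: x'x; rewrite leq_max iu.
- by rewrite /= w'w // leq_max iu.
Qed.

(** A well-founded tree of attempts is countable, hence ranked in omega_1. Conversely, the ranks
    along the initial segments of some [z] with [D (x, y, z)] would descend forever. *)
Lemma rankedP (x : baire) :
  (exists y, ~ exists z, D (x, y, z)) <-> exists w, ranked x w.
Proof.
have [wo _ _] := o1R.
split=> [[y /approx_wf wf]|[w rw]].
  have [] := wf_recursion_countable (P := fun S v => forall i, S i -> lt i v) wf.
  - by move=> u; exact: countableP.
  - by move=> S cS; exact: (omega1_bounded o1R cS).
  move=> g gP; exists (fun n => (g (odflt [::] (unpickle n)), y n)) => u a xu.
  rewrite !(pickleK (_ : seq nat)) /=; apply: gP; exists (rcons u a) => //.
  by split=> //; exists a.
exists (snd \o w) => -[z Dz]; pose g n := (w (pickle (mkseq z n))).1.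
have gS n : lt (g n.+1) (g n).
  rewrite /g mkseqS; apply: rw; exists x, (snd \o w), z; split=> //.
  by rewrite size_rcons size_mkseq mkseqS.
suff : forall i, Acc lt i -> forall n, g n <> i.
  by move=> /(_ _ (well_order_wf wo (g 0)) 0).
move=> i; elim=> {}i _ IH n gi; apply: (IH (g n.+1) _ n.+1) => //.
by rewrite -gi.
Qed.

End Shoenfield.

Lemma suslin_Sigma12 (I : Type) (R : rel I) (A : set baire) :
  omega1_order R -> Sigma12 A -> suslin (I * nat) A.
Proof.
move=> o1R [C [D cD CD] ->]; exists (ranked R D); first exact: ranked_closed.
move=> x; rewrite -(rankedP o1R cD x); split=> [[[x' y] Cxy /= x'x]|[y nz]].
  subst x'; exists y => -[z Dz]; have : (~` C) (x, y) by rewrite CD; exists (x, y, z).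
  exact.
exists (x, y) => //; apply: contrapT => nC.
have : (~` C) (x, y) by [].
by rewrite CD => -[[p z] Dz pE]; apply: nz; exists z; rewrite -pE.
Qed.

Theorem theorem12 (ma : MartinsAxiom) (not_ch : ~ CH) :
  (forall A : set baire, Sigma12 A -> dichotomy A) /\
  (forall (I : Type) (R : rel I) (B : I -> set baire),
     omega1_order R -> (forall i, borel (B i)) ->
     dichotomy (\bigcup_i B i)).
Proof.
split=> [A sA|I R B o1R bB].
  have [I [R o1R]] : exists (I : Type) (R : rel I), omega1_order R.
    (* Were the power set of [nat] countable, all its subsets would be too, and CH would hold. *)
    apply: (@omega1_exists (set nat)) => cT; apply: not_ch => X; left.
    exact: sub_countable (card_leT X) cT.
  have [i0] := omega1_inh o1R.
  apply: (suslin_dichotomy (i0, 0) (dominating_omega1 ma not_ch o1R)).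
  exact: suslin_Sigma12 o1R sA.
have [i0] := omega1_inh o1R.
apply: (suslin_dichotomy (i0, 0) (dominating_omega1 ma not_ch o1R)).
by apply: suslin_bigcup => i; exact: suslin_borel.
Qed.
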